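(* For every natural number $n$, there exist a finite set of formulas $\Gamma$ and a formula $A$ of $\mathscr{L}$ such that $\Gamma \models^\alpha_n A$ and $\Gamma \not\vdash_{\mathrm{IL}} A$, where $\vdash_{\mathrm{IL}}$ is derivability in intuitionistic propositional logic.
   Context: LANGUAGE. $\mathscr{L}$ is the propositional language whose formulas are built from infinitely many propositional letters and the atomic constant $\bot$ by $\wedge,\vee,\rightarrow$; $\neg X := X \rightarrow \bot$. $\mathrm{ATOM}$ is the set of the letters together with $\bot$. $\Gamma,\Delta$ always range over finite sets of formulas. ATOMIC RULES. A rule of level $0$ is an atom (an axiom). A rule of level $1$ infers an atom $A$ from atoms $A_1,\dots,A_m$. For $k\ge 1$, if $\Re_1,\dots,\Re_m$ are finite sets of atomic rules (some possibly empty) of maximal level $k-1$, then $([\Re_1]A_1,\dots,[\Re_m]A_m)/A$, which infers the atom $A$ from the atoms $A_1,\dots,A_m$ and discharges the rules in $\Re_i$ in the derivation of the $i$-th premise, is a rule of level $k+1$. ATOMIC BASES. An atomic base is a (possibly infinite) set $\mathfrak{B}$ of atomic rules containing the explosion rule $\bot/A$ for every atom $A$; its level is the maximal level of its rules other than the explosion rules ($0$ if there are none). $\mathbb{B}^n$ is the set of bases of level $\le n$. $\mathfrak{C}\supseteq_n\mathfrak{B}$ means $\mathfrak{C}\supseteq\mathfrak{B}$ and $\mathfrak{C}\in\mathbb{B}^n$. Derivations in $\mathfrak{B}$ are defined inductively: an atom $A$ is a single-node derivation of $A$, from no assumed rules if the axiom $A\in\mathfrak{B}$ is applied, and from the assumed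 rule $A$ if $A$ is assumed; if $\mathscr{D}_i$ derives $A_i$ from assumed rules $\mathfrak{C}_i\cup\Re_i$ ($i\le m$), then applying $R=([\Re_1]A_1,\dots,[\Re_m]A_m)/A$ yields a derivation of $A$ from $\bigcup_i\mathfrak{C}_i$ if $R\in\mathfrak{B}$, and from $\bigcup_i\mathfrak{C}_i\cup\{R\}$ if $R\notin\mathfrak{B}$. $\vdash_{\mathfrak{B}}A$ means that there is a derivation of $A$ in $\mathfrak{B}$ from no assumed rules (a closed derivation). REDUCIBILITY SEMANTICS. An argument structure $\mathscr{D}=\langle T,\langle f,h,g\rangle\rangle$ consists of a finite rooted tree $T$ with nodes labelled by formulas ($\mu\prec\nu$ means that $\nu$ lies below $\mu$, towards the root), whose leaves are partitioned into assumption leaves $\mathrm{as}(T)$ and axiom leaves $\mathrm{ax}(T)$, and of partial discharge functions: $f$ is defined on a subset of $\mathrm{as}(T)$ with $\mu\prec f(\mu)$; $h$ is defined on a subset of $\mathrm{ax}(T)$ with $\mu\prec h(\mu)$, where $h(\mu)$ and its children are labelled by atoms and $h(\mu)$ is not a value of $f$; $g$ is defined on a set of sets $K$ of edges, each $K$ consisting of all and only the edges linking a node $\mu_K$ to its children, where $\mu_K$ and its children are labelled by atoms, $\mu_K$ is not a value of $f$, $\mu_K\prec g(K)$, $g(K)$ and its children are labelled by atoms, and $g(K)$ is not a value of $f$. ($f$ discharges assumptions; $h$ and $g$ discharge assumed atomic rules of level $0$ and higher.) The root label is the conclusion. $\mathscr{D}$ is from $\Gamma$ to $A$ if $\Gamma$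 is the set of its undischarged assumptions and $A$ its conclusion; it is closed if $\Gamma=\emptyset$, open otherwise. Derivations in $\mathfrak{B}$ are regarded as argument structures with all labels atomic and $f$ empty. $\mathscr{D}[\mathscr{D}^{**}/\mathscr{D}^*]$ is the result of replacing the sub-structure $\mathscr{D}^*$ by $\mathscr{D}^{**}$ in $\mathscr{D}$, the discharge functions being redefined in the natural way (discharges of surviving or copied assumptions and assumed rules take place at the corresponding nodes; the others disappear). If $\mathscr{D}$ is from $\Gamma=\{\mu_1,\dots,\mu_m\}$ and $\sigma$ assigns to each $\mu_i$ an argument structure $\sigma(\mu_i)$ with the same conclusion as $\mu_i$, then $\mathscr{D}^\sigma=\mathscr{D}[\sigma(\mu_1),\dots,\sigma(\mu_m)/\mu_1,\dots,\mu_m]$; it is a closed $\sigma$-instance if all $\sigma(\mu_i)$ are closed. An inference is a triple $\langle\langle\mathscr{D}_1,\dots,\mathscr{D}_m\rangle,A,\delta\rangle$ with $\delta$ an extension of the discharge functions of the $\mathscr{D}_i$; its associated argument structure joins the trees of the $\mathscr{D}_i$ by a new root $A$ and adds the discharges $\delta$. A rule is a (recursive) set of inferences, its instances. Introduction rules are Gentzen's: $A,B/A\wedge B$; $A_i/A_1\vee A_2$ ($i=1,2$); $[A]B/A\rightarrow B$. $\mathscr{D}$ is canonical if it is associated to an instance of an introduction rule. A reduction for a rule $R$ is a map $\phi$ from and to argument structures, defined on some set $\mathbb{D}$ of argument structures associated to instances of $R$, such that for all $\mathscr{D}\in\mathbb{D}$: (a) if $\mathscr{D}$ is from $\Gamma$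 to $A$, then $\phi(\mathscr{D})$ is from some $\Gamma^*\subseteq\Gamma$ to $A$; (b) for all $\sigma$, $\phi$ is defined on $\mathscr{D}^\sigma$ and $\phi(\mathscr{D}^\sigma)=\phi(\mathscr{D})^\sigma$. For a set $\mathfrak{J}$ of reductions, $\mathscr{D}\leq_{\mathfrak{J}}\mathscr{D}^*$ is the reflexive-transitive closure of: $\mathscr{D}^*=\mathscr{D}[\phi(\mathscr{D}^{**})/\mathscr{D}^{**}]$ for some sub-structure $\mathscr{D}^{**}$ of $\mathscr{D}$ and some $\phi\in\mathfrak{J}$. An argument is a pair $\langle\mathscr{D},\mathfrak{J}\rangle$. It is $n$-valid on $\mathfrak{B}\in\mathbb{B}^n$ iff: when $\mathscr{D}$ is closed with atomic conclusion, $\mathscr{D}\leq_{\mathfrak{J}}\mathscr{D}^*$ for some closed derivation $\mathscr{D}^*$ in $\mathfrak{B}$; when $\mathscr{D}$ is closed with non-atomic conclusion, $\mathscr{D}\leq_{\mathfrak{J}}\mathscr{D}^*$ for some canonical $\mathscr{D}^*$ whose immediate sub-structures, paired with $\mathfrak{J}$, are $n$-valid on $\mathfrak{B}$; when $\mathscr{D}$ is open with undischarged assumptions $\Gamma$, for all $\sigma$ assigning closed structures, all sets of reductions $\mathfrak{J}^+\supseteq\mathfrak{J}$ and all $\mathfrak{C}\supseteq_n\mathfrak{B}$, if $\langle\sigma(\mu),\mathfrak{J}^+\rangle$ is $n$-valid on $\mathfrak{C}$ for all $\mu\in\Gamma$, then $\langle\mathscr{D}^\sigma,\mathfrak{J}^+\rangle$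 is $n$-valid on $\mathfrak{C}$. An argument is $n$-valid iff it is $n$-valid on every $\mathfrak{B}\in\mathbb{B}^n$. $\Gamma\models^\alpha_nA$ means that there is an $n$-valid argument $\langle\mathscr{D},\mathfrak{J}\rangle$ with $\mathscr{D}$ from $\Gamma$ to $A$. *)

(* Defs.v *)
From Stdlib Require Import Arith List Relations Lia.
Import ListNotations.

Inductive atom : Type :=
| Letter (p : nat)
| Falsum.

Inductive form : Type :=
| Atom (a : atom)
| And (X Y : form)
| Or (X Y : form)
| Imp (X Y : form).

Definition atomic (X : form) : Prop := exists a, X = Atom a.

Inductive IL : list form -> form -> Prop :=
| IL_hyp G X : In X G -> IL G X
| IL_andI G X Y : IL G X -> IL G Y -> IL G (And X Y)
| IL_andE1 G X Y : IL G (And X Y) -> IL G X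
| IL_andE2 G X Y : IL G (And X Y) -> IL G Y
| IL_orI1 G X Y : IL G X -> IL G (Or X Y)
| IL_orI2 G X Y : IL G Y -> IL G (Or X Y)
| IL_orE G X Y Z : IL G (Or X Y) -> IL (X :: G) Z -> IL (Y :: G) Z -> IL G Z
| IL_impI G X Y : IL (X :: G) Y -> IL G (Imp X Y)
| IL_impE G X Y : IL G (Imp X Y) -> IL G X -> IL G Y
| IL_botE G X : IL G (Atom Falsum) -> IL G X.

(* [ARule [(R1, A1); ...; (Rm, Am)] A] is the rule ([R1]A1, ..., [Rm]Am) / A.
   An axiom is a rule without premises.  The lists Ri stand for finite sets,
   which is what [same_rule] accounts for. *)
Inductive arule : Type :=
| ARule (prems : list (list arule * atom)) (concl : atom).

Inductive same_rule : arule -> arule -> Prop :=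
| same_rule_intro ps qs a :
    Forall2 (fun p q =>
        snd p = snd q /\
        (forall R, In R (fst p) -> exists R', In R' (fst q) /\ same_rule R R') /\
        (forall R', In R' (fst q) -> exists R, In R (fst p) /\ same_rule R R'))
      ps qs ->
    same_rule (ARule ps a) (ARule qs a).

(* 0 without premises, 1 if there are premises but no rule is discharged, and
   otherwise 2 plus the maximal level of the discharged rules. *)
Fixpoint level (R : arule) : nat :=
  match R with
  | ARule ps _ =>
      list_max (map (fun p =>
        match p with
        | (Rs, _) => Nat.max 1 (list_max (map (fun R' => 2 + level R') Rs))
        end) ps)
  end.

Definition explosion (a : atom) : arule := ARule [([], Falsum)] a.

Definition ruleset : Type := arule -> Prop.

Definition atomic_base (B : ruleset) : Prop :=
  (forall a, B (explosion a)) /\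
  (forall R R', same_rule R R' -> B R -> B R').

Definition base_of_level (n : nat) (B : ruleset) : Prop :=
  atomic_base B /\
  forall R, B R -> (exists a, R = explosion a) \/ level R <= n.

Definition extends (n : nat) (B C : ruleset) : Prop :=
  (forall R, B R -> C R) /\ base_of_level n C.

(* The discharge functions are stored in the tree as distances: 0 refers to the
   parent of a node, 1 to its grandparent, and so on.
   - [Hyp A i] is an assumption leaf; f sends it to its ancestor number i, if
     it has that many ancestors.  Otherwise the leaf is undischarged.
   - [Node A t ds] is an inference node or, if [ds = nil], an axiom leaf.  If
     [t = Some i] and ancestor number i exists, then that ancestor is the value
     of g at the edges above the node (of h at the leaf).  Otherwise this
     inference is not discharged.
   Hence the sub-structures of [D] are literally its subtrees.  The excess of an
   index over the number of ancestors is a name for an undischarged item; when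
   the structure is plugged into a larger one at the place it came from, the
   name tells which node below discharges the item and its copies.  Names have
   no other content: see [reduction_for]. *)
Inductive astr : Type :=
| Hyp (A : form) (i : nat)
| Node (A : form) (t : option nat) (ds : list astr).

Definition concl (D : astr) : form :=
  match D with Hyp A _ => A | Node A _ _ => A end.

Definition premises (D : astr) : list astr :=
  match D with Hyp _ _ => [] | Node _ _ ds => ds end.

(* [undis D i A]: some undischarged assumption leaf of [D] has label [A] and
   name [i].  If [D] is an immediate sub-structure, name 0 means that the leaf
   is discharged by the inference right below [D]. *)
Inductive undis : astr -> nat -> form -> Prop :=
| undis_leaf A i : undis (Hyp A i) i A
| undis_node B t ds E i A :
    In E ds -> undis E (S i) A -> undis (Node B t ds) i A.

(* Likewise for the named undischarged inferences, with conclusion and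
   premises. *)
Inductive undis_rule : astr -> nat -> form -> list form -> Prop :=
| undis_rule_root A i ds : undis_rule (Node A (Some i) ds) i A (map concl ds)
| undis_rule_node B t ds E i A As :
    In E ds -> undis_rule E (S i) A As -> undis_rule (Node B t ds) i A As.

(* The root of [Node A t ds] is a value of f, respectively of g or h. *)
Definition f_value (ds : list astr) : Prop :=
  exists E X, In E ds /\ undis E 0 X.
Definition gh_value (ds : list astr) : Prop :=
  exists E X Xs, In E ds /\ undis_rule E 0 X Xs.

Definition atomic_step (A : form) (ds : list astr) : Prop :=
  atomic A /\ forall E, In E ds -> atomic (concl E).

Inductive argstr : astr -> Prop :=
| argstr_hyp A i : argstr (Hyp A i)
| argstr_node A t ds :
    (forall E, In E ds -> argstr E) ->
    (gh_value ds -> atomic_step A ds /\ ~ f_value ds) ->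
    (t <> None -> ds <> [] -> atomic_step A ds /\ ~ f_value ds) ->
    argstr (Node A t ds).

Definition closed (D : astr) : Prop := forall i A, ~ undis D i A.

Definition from_to (D : astr) (G : list form) (A : form) : Prop :=
  (forall X, In X G <-> exists i, undis D i X) /\ concl D = A.

(* [derivation B ctx D a]: [D] is a derivation of [a] in [B], to be placed below
   the discharging inferences recorded in [ctx], whose i-th entry is the set of
   rules that ancestor number i may discharge in this branch. *)
Inductive derivation (B : ruleset) : list (list arule) -> astr -> atom -> Prop :=
| derivation_app ctx t ps a ds :
    match t with
    | None => B (ARule ps a)
    | Some i =>
        match nth_error ctx i with
        | None => B (ARule ps a)
        | Some Rs => In (ARule ps a) Rs /\ (ps <> [] -> ~ B (ARule ps a))
        end
    end ->
    Forall2 (fun p D => derivation B (fst p :: ctx) D (snd p)) ps ds ->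
    derivation B ctx (Node (Atom a) t ds) a.

Definition closed_derivation (B : ruleset) (D : astr) : Prop :=
  exists a, derivation B [] D a.

(* [lift k c D] adds [k] to the names in [D], where [D] lies at depth [c]. *)
Definition shift (k c i : nat) : nat := if i <? c then i else i + k.

Fixpoint lift (k c : nat) (D : astr) : astr :=
  match D with
  | Hyp A i => Hyp A (shift k c i)
  | Node A t ds =>
      Node A (option_map (shift k c) t) (map (lift k (S c)) ds)
  end.

(* At depth [d], renames by [r] the undischarged inferences, [None] meaning
   that the name is forgotten. *)
Definition rename (r : nat -> option nat) (d : nat) (t : option nat)
  : option nat :=
  match t with
  | None => None
  | Some i =>
      if i <? d then Some i else option_map (fun j => j + d) (r (i - d))
  end.

(* The undischarged assumption with name [i] and label [A] becomes [s i A]. *)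
Fixpoint subst (s : nat -> form -> astr) (r : nat -> option nat)
    (d : nat) (D : astr) : astr :=
  match D with
  | Hyp A i => if i <? d then Hyp A i else lift d 0 (s (i - d) A)
  | Node A t ds => Node A (rename r d t) (map (subst s r (S d)) ds)
  end.

Definition good_subst (s : nat -> form -> astr) : Prop :=
  forall i A, argstr (s i A) /\ concl (s i A) = A.

Definition forget : astr -> astr :=
  subst (fun _ A => Hyp A 0) (fun _ => None) 0.

(* [instance V 0 D D']: [D'] is the closed instance of [D] for some choice, at
   each undischarged assumption leaf separately (leaves with the same name
   included), of a closed structure satisfying [V]. *)
Inductive instance (V : form -> astr -> Prop) : nat -> astr -> astr -> Prop :=
| instance_dis d A i : i < d -> instance V d (Hyp A i) (Hyp A i)
| instance_hyp d A i E :
    d <= i -> argstr E -> closed E -> concl E = A -> V A E ->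
    instance V d (Hyp A i) (lift d 0 E)
| instance_node d A t ds ds' :
    Forall2 (instance V (S d)) ds ds' ->
    instance V d (Node A t ds) (Node A t ds').

(* The extension of the discharge functions is carried by the premises, whose
   items with name 0 are those discharged by the inference. *)
Definition inference : Type := (list astr * form)%type.

Definition associated (D : astr) (I : inference) : Prop :=
  exists t, D = Node (snd I) t (fst I).

(* Asking for recursive rules would not change the notion of reduction, since
   a reduction for any rule is one for the rule made of all inferences. *)
Definition rule : Type := inference -> Prop.

Inductive canonical : astr -> Prop :=
| canonical_and X Y D1 D2 :
    concl D1 = X -> concl D2 = Y -> ~ f_value [D1; D2] ->
    canonical (Node (And X Y) None [D1; D2])
| canonical_or1 X Y D1 :
    concl D1 = X -> ~ f_value [D1] -> canonical (Node (Or X Y) None [D1])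
| canonical_or2 X Y D1 :
    concl D1 = Y -> ~ f_value [D1] -> canonical (Node (Or X Y) None [D1])
| canonical_imp X Y D1 :
    concl D1 = Y -> (forall Z, undis D1 0 Z -> Z = X) ->
    canonical (Node (Imp X Y) None [D1]).

Definition pmap : Type := astr -> option astr.

(* The third clause makes the named inferences of the result copies of those of
   the argument, so that they are discharged at the corresponding nodes.  The
   fourth clause is commutation with substitutions; the renamings [r] in it and
   the last clause say that names are immaterial: [phi] commutes with renaming,
   and whether it is defined does not depend on the names. *)
Definition reduction_for (R : rule) (phi : pmap) : Prop :=
  (forall D E, phi D = Some E ->
     argstr D /\ argstr E /\ exists I, R I /\ associated D I) /\
  (forall D E, phi D = Some E ->
     concl E = concl D /\ forall i A, undis E i A -> undis D i A) /\
  (forall D E, phi D = Some E ->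
     forall i A As, undis_rule E i A As -> undis_rule D i A As) /\
  (forall D E, phi D = Some E ->
     forall s r, good_subst s -> phi (subst s r 0 D) = Some (subst s r 0 E)) /\
  (forall D F, argstr D -> phi (forget D) = Some F -> exists E, phi D = Some E).

Definition reduction (phi : pmap) : Prop := exists R, reduction_for R phi.

Definition reductions (J : pmap -> Prop) : Prop :=
  forall phi, J phi -> reduction phi.

Inductive step (J : pmap -> Prop) : astr -> astr -> Prop :=
| step_root phi D E : J phi -> phi D = Some E -> step J D E
| step_sub A t ds1 D E ds2 :
    step J D E -> step J (Node A t (ds1 ++ D :: ds2)) (Node A t (ds1 ++ E :: ds2)).

Definition reduces (J : pmap -> Prop) : astr -> astr -> Prop :=
  clos_refl_trans astr (step J).

Definition vpred : Type := ruleset -> (pmap -> Prop) -> astr -> Prop.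

(* Validity of possibly open arguments, given the validity [V] of closed
   arguments for the conclusion, and [H A] for an assumption [A]. *)
Definition open_valid (n : nat) (H : form -> vpred) (V : vpred) : vpred :=
  fun B J D =>
    (closed D -> V B J D) /\
    (~ closed D ->
     forall (J' : pmap -> Prop) (C : ruleset) (D' : astr),
       reductions J' -> (forall phi, J phi -> J' phi) -> extends n B C ->
       instance (fun A E => H A C J' E) 0 D D' ->
       V C J' D').

(* [closed_valid n A] is validity for closed arguments with conclusion [A], by
   recursion on [A]: the immediate sub-structures of a closed canonical
   structure are closed, except for [Imp X Y], when they may have undischarged
   assumptions, all of the form [X].  [valid_closed_atomic],
   [valid_closed_compound] and [valid_open] below are the defining clauses
   of validity. *)
Fixpoint closed_valid (n : nat) (A : form) : vpred :=
  match A with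
  | Atom _ => fun B J D =>
      exists E, reduces J D E /\ closed_derivation B E
  | And X Y => fun B J D =>
      exists D1 D2, let E := Node (And X Y) None [D1; D2] in
        reduces J D E /\ canonical E /\
        closed_valid n X B J D1 /\ closed_valid n Y B J D2
  | Or X Y => fun B J D =>
      exists D1, let E := Node (Or X Y) None [D1] in
        reduces J D E /\ canonical E /\
        ((concl D1 = X /\ closed_valid n X B J D1) \/
         (concl D1 = Y /\ closed_valid n Y B J D1))
  | Imp X Y => fun B J D =>
      exists D1, let E := Node (Imp X Y) None [D1] in
        reduces J D E /\ canonical E /\
        open_valid n (fun _ => closed_valid n X) (closed_valid n Y) B J D1
  end.

Definition valid_on (n : nat) (B : ruleset) (J : pmap -> Prop) (D : astr) : Prop :=
  open_valid n (closed_valid n) (closed_valid n (concl D)) B J D.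

Definition valid (n : nat) (J : pmap -> Prop) (D : astr) : Prop :=
  forall B, base_of_level n B -> valid_on n B J D.

Definition consequence (n : nat) (G : list form) (A : form) : Prop :=
  exists (D : astr) (J : pmap -> Prop),
    argstr D /\ reductions J /\ from_to D G A /\ valid n J D.

Lemma step_sound J D E :
  reductions J -> step J D E ->
  concl E = concl D /\ (forall i A, undis E i A -> undis D i A) /\
  (forall i A As, undis_rule E i A As -> undis_rule D i A As) /\
  (argstr D -> argstr E).
Proof.
  intros HJ Hs; induction Hs as [phi D E Hphi HDE | A t ds1 D E ds2 Hs IH].
  - destruct (HJ _ Hphi) as [R (H1 & H2 & H3 & _)].
    destruct (H1 _ _ HDE) as (_ & HE & _), (H2 _ _ HDE) as [Hc Hu].
    repeat split; eauto.
  - destruct IH as (Hc & Hu & Hr & Ha).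
    assert (Hin : forall F, In F (ds1 ++ E :: ds2) -> F = E \/ In F (ds1 ++ D :: ds2)).
    { intros F; rewrite !in_app_iff; simpl; intuition. }
    assert (HD : In D (ds1 ++ D :: ds2)) by (apply in_elt).
    assert (Hmap : map concl (ds1 ++ E :: ds2) = map concl (ds1 ++ D :: ds2)).
    { rewrite !map_app; simpl; now rewrite Hc. }
    assert (Hf : f_value (ds1 ++ E :: ds2) -> f_value (ds1 ++ D :: ds2)).
    { intros (F & X & HF & HX); destruct (Hin _ HF) as [-> | HF'];
        [exists D, X | exists F, X]; auto. }
    assert (Hat : forall B, atomic_step B (ds1 ++ D :: ds2) ->
                            atomic_step B (ds1 ++ E :: ds2)).
    { intros B [HB Hall]; split; [exact HB |].
      intros F HF; destruct (Hin _ HF) as [-> | HF']; [rewrite Hc |]; auto. }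
    split; [reflexivity |]; split; [| split].
    + intros i X HX; inversion HX; subst.
      match goal with H : In ?F (_ ++ E :: _) |- _ => destruct (Hin _ H) as [-> |] end;
        econstructor; eauto.
    + intros i X Xs HX; inversion HX; subst.
      * rewrite Hmap; constructor.
      * match goal with H : In ?F (_ ++ E :: _) |- _ =>
          destruct (Hin _ H) as [-> |] end; econstructor; eauto.
    + intros HD'; inversion HD' as [| ? ? ? Hall Hgh Ht]; subst.
      constructor.
      * intros F HF; destruct (Hin _ HF) as [-> |]; auto.
      * intros (F & X & Xs & HF & HX).
        destruct Hgh as [Hs1 Hs2]; [| split; auto].
        destruct (Hin _ HF) as [-> |]; [exists D, X, Xs | exists F, X, Xs]; auto.
      * intros Ht1 _; destruct (Ht Ht1) as [Hs1 Hs2]; [| split; auto].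
        intros H0; rewrite H0 in HD; destruct HD.
Qed.

Lemma reduces_sound J D E :
  reductions J -> reduces J D E ->
  concl E = concl D /\ (forall i A, undis E i A -> undis D i A) /\
  (argstr D -> argstr E).
Proof.
  intros HJ Hr; induction Hr as [D E Hs | | D E F _ IH1 _ IH2].
  - destruct (step_sound _ _ _ HJ Hs) as (? & ? & _ & ?); auto.
  - auto.
  - destruct IH1 as (H1 & H2 & H3), IH2 as (H4 & H5 & H6).
    rewrite H4; auto 6.
Qed.

Lemma valid_closed_atomic n B J D :
  closed D -> atomic (concl D) ->
  (valid_on n B J D <-> exists E, reduces J D E /\ closed_derivation B E).
Proof.
  intros HD [a Ha]; unfold valid_on, open_valid; rewrite Ha; simpl; tauto.
Qed.

Lemma instance_ext (V W : form -> astr -> Prop) D :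
  forall d D', (forall i A, undis D i A -> d <= i ->
     forall E, closed E -> concl E = A -> V A E -> W A E) ->
  instance V d D D' -> instance W d D D'.
Proof.
  revert D; fix IH 1; intros [A i | A t ds] d D' Hext Hi.
  - inversion Hi; subst; constructor; auto.
    apply (Hext i); auto; constructor.
  - inversion Hi as [| | ? ? ? ? ds' Hds]; subst; constructor.
    assert (H : forall E, In E ds -> forall i A, undis E i A -> S d <= i ->
                forall F, closed F -> concl F = A -> V A F -> W A F).
    { intros E HE [| i] X HX Hle; [lia |].
      apply (Hext i); [econstructor; eauto | lia]. }
    clear Hi Hext; revert ds' Hds H; induction ds as [| E ds IHds];
      intros ds' Hds H; inversion Hds; subst; constructor.
    + apply IH; [apply H; now left | assumption].
    + apply IHds; [assumption |]; intros; eapply H; eauto; now right.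
Qed.

Lemma open_valid_ext n (H H' : form -> vpred) V B J D :
  (forall i A, undis D i A -> H A = H' A) ->
  open_valid n H V B J D <-> open_valid n H' V B J D.
Proof.
  intros Heq; split; intros [H1 H2]; split; auto;
    intros Hc J' C D' HJ' HJ HC Hi; apply (H2 Hc J' C D' HJ' HJ HC);
    eapply instance_ext; [| exact Hi | | exact Hi];
    intros i A HA _ E _ _; cbv beta; rewrite (Heq i A HA); auto.
Qed.

Lemma closed_premise A t ds E :
  closed (Node A t ds) -> ~ f_value ds -> In E ds -> closed E.
Proof.
  intros Hc Hf HE [| i] X HX.
  - apply Hf; exists E, X; auto.
  - apply (Hc i X); econstructor; eauto.
Qed.

Lemma valid_on_closed n B J D :
  closed D -> (valid_on n B J D <-> closed_valid n (concl D) B J D).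
Proof. unfold valid_on, open_valid; tauto. Qed.

Lemma valid_closed_compound n B J D :
  reductions J -> closed D -> ~ atomic (concl D) ->
  (valid_on n B J D <->
   exists E, reduces J D E /\ canonical E /\
             forall F, In F (premises E) -> valid_on n B J F).
Proof.
  intros HJ HD Hna; rewrite valid_on_closed by assumption.
  assert (Hcl : forall E, reduces J D E -> closed E).
  { intros E HE i A HA; destruct (reduces_sound _ _ _ HJ HE) as (_ & Hu & _).
    exact (HD i A (Hu _ _ HA)). }
  assert (Hcv : forall A ds F, reduces J D (Node A None ds) -> ~ f_value ds ->
      In F ds -> valid_on n B J F -> closed_valid n (concl F) B J F).
  { intros A ds F Hr Hf HF; apply valid_on_closed.
    eapply closed_premise; eauto. }
  assert (Himp : forall X Y D1, closed (Node (Imp X Y) None [D1]) ->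
      canonical (Node (Imp X Y) None [D1]) ->
      (open_valid n (fun _ => closed_valid n X) (closed_valid n Y) B J D1 <->
       valid_on n B J D1)).
  { intros X Y D1 Hc Hcan; inversion Hcan; subst.
    unfold valid_on; apply open_valid_ext; intros [| i] A HA.
    - f_equal; symmetry; auto.
    - destruct (Hc i A); econstructor; [now left | exact HA]. }
  split.
  - destruct (concl D) as [a | X Y | X Y | X Y] eqn:HcD; simpl.
    + destruct Hna; now exists a.
    + intros (D1 & D2 & Hr & Hcan & H1 & H2).
      exists (Node (And X Y) None [D1; D2]); split; [assumption | split; [assumption |]].
      assert (Hf : ~ f_value [D1; D2]) by (inversion Hcan; assumption).
      assert (HX : concl D1 = X /\ concl D2 = Y) by (inversion Hcan; auto).
      destruct HX as [<- <-].
      intros F HF; assert (Hc := closed_premise _ _ _ _ (Hcl _ Hr) Hf HF).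
      rewrite valid_on_closed by assumption.
      destruct HF as [<- | [<- | []]]; assumption.
    + intros (D1 & Hr & Hcan & Hor).
      exists (Node (Or X Y) None [D1]); split; [assumption | split; [assumption |]].
      assert (Hf : ~ f_value [D1]) by (inversion Hcan; assumption).
      intros F HF; assert (Hc := closed_premise _ _ _ _ (Hcl _ Hr) Hf HF).
      rewrite valid_on_closed by assumption.
      destruct HF as [<- | []]; destruct Hor as [[-> H] | [-> H]]; assumption.
    + intros (D1 & Hr & Hcan & Ho).
      exists (Node (Imp X Y) None [D1]); split; [assumption | split; [assumption |]].
      intros F [<- | []]; apply (Himp X Y); auto.
  - intros (E & Hr & Hcan & Hall).
    destruct (reduces_sound _ _ _ HJ Hr) as (HE & _ & _); rewrite <- HE.
    destruct Hcan as [X Y D1 D2 HX HY Hf | X Y D1 HX Hf | X Y D1 HX Hf | X Y D1 HY Hz];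
      simpl in *.
    + exists D1, D2; split; [assumption |]; split; [now constructor |].
      rewrite <- HX, <- HY.
      split; eapply Hcv; eauto; simpl; auto.
    + exists D1; split; [assumption |]; split; [now apply canonical_or1 |].
      left; split; [assumption |]; rewrite <- HX.
      eapply Hcv; eauto; simpl; auto.
    + exists D1; split; [assumption |]; split; [now apply canonical_or2 |].
      right; split; [assumption |]; rewrite <- HX.
      eapply Hcv; eauto; simpl; auto.
    + exists D1; split; [assumption |]; split; [now constructor |].
      apply (Himp X Y); auto; now constructor.
Qed.

Lemma concl_lift k c D : concl (lift k c D) = concl D.
Proof. now destruct D. Qed.

Lemma instance_concl V d D D' : instance V d D D' -> concl D' = concl D.
Proof. intros H; inversion H; subst; rewrite ?concl_lift; auto. Qed.

Lemma undis_lift k D : forall c i A,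
  undis (lift k c D) i A ->
  (i < c /\ undis D i A) \/ (c + k <= i /\ undis D (i - k) A).
Proof.
  revert D; fix IH 1; intros [A i | A t ds] c j X HX; simpl in HX.
  - inversion HX as [A' j' |]; subst; unfold shift.
    destruct (Nat.ltb_spec i c); [left; split; [lia | constructor] |].
    right; split; [lia |]; replace (i + k - k) with i by lia; constructor.
  - inversion HX as [| ? ? ? E ? ? HE HX']; subst.
    assert (H : exists E', In E' ds /\
       ((S j < S c /\ undis E' (S j) X) \/
        (S c + k <= S j /\ undis E' (S j - k) X))).
    { clear HX; induction ds as [| E' ds IHds]; [destruct HE |]; destruct HE as [<- | HE].
      - exists E'; split; [now left | exact (IH _ _ _ _ HX')].
      - destruct (IHds HE) as (E'' & ? & ?); exists E''; split; [now right |]; auto. }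
    destruct H as (E' & HE' & [[Hl Hu] | [Hl Hu]]).
    + left; split; [lia | econstructor; eauto].
    + right; split; [lia |].
      replace (S j - k) with (S (j - k)) in Hu by lia; econstructor; eauto.
Qed.

Lemma instance_closed V D : forall d D' i A,
  instance V d D D' -> undis D' i A -> i < d.
Proof.
  revert D; fix IH 1; intros [A i | A t ds] d D' j X Hi HX.
  - inversion Hi as [| ? ? ? E Hle Ha Hc |]; subst.
    + inversion HX; subst; assumption.
    + destruct (undis_lift _ _ _ _ _ HX) as [[H _] | [_ H]]; [lia |].
      destruct (Hc _ _ H).
  - inversion Hi as [| | ? ? ? ? ds' Hds]; subst.
    inversion HX as [| ? ? ? E ? ? HE HX']; subst; clear Hi HX.
    apply Nat.succ_lt_mono; revert ds' Hds HE.
    induction ds as [| E0 ds IHds]; intros ds' Hds HE; inversion Hds; subst;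
      [destruct HE |]; destruct HE as [<- | HE]; eauto.
Qed.

Lemma valid_open n B J D :
  ~ closed D ->
  (valid_on n B J D <->
   forall (J' : pmap -> Prop) (C : ruleset) (D' : astr),
     reductions J' -> (forall phi, J phi -> J' phi) -> extends n B C ->
     instance (fun A E => valid_on n C J' E) 0 D D' -> valid_on n C J' D').
Proof.
  intros HD.
  assert (Hres : forall V C J' D', instance V 0 D D' ->
      (valid_on n C J' D' <-> closed_valid n (concl D) C J' D')).
  { intros V C J' D' Hi; rewrite <- (instance_concl _ _ _ _ Hi).
    apply valid_on_closed; intros i A HA.
    exact (Nat.nlt_0_r _ (instance_closed _ _ _ _ _ _ Hi HA)). }
  unfold valid_on at 1, open_valid; split.
  - intros [_ H] J' C D' HJ' HJ HC Hi; apply (Hres _ _ _ _ Hi).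
    apply (H HD J' C D' HJ' HJ HC); eapply instance_ext; [| exact Hi].
    intros i A _ _ E HE <-; apply valid_on_closed; assumption.
  - intros H; split; [contradiction |].
    intros _ J' C D' HJ' HJ HC Hi; apply (Hres _ _ _ _ Hi).
    apply (H J' C D' HJ' HJ HC); eapply instance_ext; [| exact Hi].
    intros i A _ _ E HE <-; apply valid_on_closed; assumption.
Qed.

(* Main.v *)
Require Import Defs.
From Stdlib Require Import List.
From Stdlib Require Import Arith Relations Lia ClassicalEpsilon.
Import ListNotations.

(** For atoms [p], [q], [r], the formula [(p -> q) \/ (p -> r)] is a consequence
    of [p -> q \/ r], at every level [n].

    Take for [J] the set of all reductions.  It contains, for every closed
    argument structure [E] without named inferences, the reduction that sends
    every inference with the conclusion of [E] to [E] ([constant_reduction]).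
    Hence a closed inference is valid on a base as soon as some such [E] with
    the same conclusion is valid on it, and the validity of a closed inference of
    an atom is just the derivability of the atom in the base ([closed_valid_derivable],
    [derivable_closed_valid]).

    Let [p -> q \/ r] be valid on [C], and let [C + p] be [C] with the axiom [p]
    added.  This is still a base of level [n], since axioms have level 0, and it
    derives [p]; so it derives [q] or [r] ([split_derivable]).  Say it derives
    [q].  An extension of [C] that derives [p] then derives [q], because a
    derivation of [p] can replace the axiom [p] ([derivable_cut]).  So [p -> q]
    is valid on [C].

    The inference is not intuitionistically derivable for distinct letters: it
    fails at the root of the Kripke model in which the root forces no letter, and
    has two successors, one forcing [p] and [q], the other [p] and [r]
    ([not_IL_split]). *)

(** * Argument structures *)

Lemma astr_nested_ind (P : astr -> Prop) :
  (forall A i, P (Hyp A i)) ->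
  (forall A t ds, (forall E, In E ds -> P E) -> P (Node A t ds)) ->
  forall D, P D.
Proof.
  intros Hh Hn; fix IH 1; intros [A i | A t ds]; [apply Hh | apply Hn].
  induction ds as [| E ds IHds]; intros F HF; [destruct HF |].
  destruct HF as [<- | HF]; [apply IH | exact (IHds F HF)].
Qed.

Lemma undis_rule_Node B t ds i A As :
  undis_rule (Node B t ds) i A As ->
  (t = Some i /\ B = A) \/ exists E, In E ds /\ undis_rule E (S i) A As.
Proof. intros H; inversion H; subst; eauto. Qed.

Lemma undis_rule_lift k D : forall c i A As,
  undis_rule (lift k c D) i A As ->
  (i < c /\ exists Bs, undis_rule D i A Bs) \/ c + k <= i.
Proof.
  induction D as [A i | A t ds IH] using astr_nested_ind; intros c j X Xs HX;
    simpl in HX; [inversion HX |]; apply undis_rule_Node in HX;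
    destruct HX as [[Ht ->] | (E & HE & HX')].
  - destruct t as [i |]; simpl in Ht; [| discriminate].
    injection Ht as <-; unfold shift.
    destruct (Nat.ltb_spec i c) as [Hlt | Hle]; [left; split; [lia |] | right; lia].
    exists (map concl ds); constructor.
  - apply in_map_iff in HE; destruct HE as (F & <- & HF).
    destruct (IH F HF _ _ _ _ HX') as [[Hl [Bs Hu]] | Hl]; [left | right; lia].
    split; [lia |]; exists Bs; econstructor; eauto.
Qed.

(** A map on the premises of a node that keeps their conclusions and adds
    nothing that the node discharges preserves the conditions on discharge. *)
Lemma argstr_map_node g A t t' ds :
  (forall E, In E ds -> argstr (g E)) ->
  (forall E, In E ds -> concl (g E) = concl E) ->
  (forall E X, In E ds -> undis (g E) 0 X -> undis E 0 X) ->
  (forall E X Xs, In E ds -> undis_rule (g E) 0 X Xs ->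
     exists Ys, undis_rule E 0 X Ys) ->
  (t' <> None -> t <> None) ->
  argstr (Node A t ds) -> argstr (Node A t' (map g ds)).
Proof.
  intros Hg Hc Hu Hr Ht HD; inversion HD as [| ? ? ? _ Hgh Hn]; subst.
  assert (Hf : f_value (map g ds) -> f_value ds).
  { intros (E & X & HE & HX); apply in_map_iff in HE; destruct HE as (F & <- & HF).
    exists F, X; auto. }
  assert (Ha : atomic_step A ds -> atomic_step A (map g ds)).
  { intros [H1 H2]; split; [assumption |]; intros E HE.
    apply in_map_iff in HE; destruct HE as (F & <- & HF); rewrite Hc; auto. }
  constructor.
  - intros E HE; apply in_map_iff in HE; destruct HE as (F & <- & HF); auto.
  - intros (E & X & Xs & HE & HX).
    apply in_map_iff in HE; destruct HE as (F & <- & HF).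
    destruct (Hr F X Xs HF HX) as [Ys HY].
    destruct Hgh as [H1 H2]; [exists F, X, Ys; auto |]; split; auto.
  - intros Ht' Hds; destruct (Hn (Ht Ht')) as [H1 H2]; [| split; auto].
    intros ->; now apply Hds.
Qed.

Lemma argstr_lift k D : forall c, argstr D -> argstr (lift k c D).
Proof.
  induction D as [A i | A t ds IH] using astr_nested_ind; intros c HD; simpl;
    [constructor |].
  inversion HD as [| ? ? ? Hall _ _]; subst.
  eapply argstr_map_node; [| | | | | exact HD].
  - auto.
  - intros; apply concl_lift.
  - intros E X _ HX; destruct (undis_lift _ _ _ _ _ HX) as [[_ H] | [H _]];
      [assumption | lia].
  - intros E X Xs _ HX; destruct (undis_rule_lift _ _ _ _ _ _ HX) as [[_ H] | H];
      [assumption | lia].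
  - now destruct t.
Qed.

Lemma concl_subst s r d D : good_subst s -> concl (subst s r d D) = concl D.
Proof.
  intros Hs; destruct D as [A i | A t ds]; simpl; [| reflexivity].
  destruct (i <? d); [reflexivity |]; rewrite concl_lift; apply Hs.
Qed.

Lemma undis_subst s r D : forall d i A,
  i < d -> undis (subst s r d D) i A -> undis D i A.
Proof.
  induction D as [A i | A t ds IH] using astr_nested_ind; intros d j X Hj HX;
    simpl in HX.
  - destruct (i <? d); [assumption |].
    destruct (undis_lift _ _ _ _ _ HX) as [[H _] | [H _]]; lia.
  - inversion HX as [| ? ? ? E ? ? HE HX']; subst.
    apply in_map_iff in HE; destruct HE as (F & <- & HF).
    econstructor; [exact HF |]; apply (IH F HF (S d)); [lia | assumption].
Qed.

Lemma undis_rule_subst s r D : forall d i A As,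
  i < d -> undis_rule (subst s r d D) i A As -> exists Bs, undis_rule D i A Bs.
Proof.
  induction D as [A i | A t ds IH] using astr_nested_ind; intros d j X Xs Hj HX;
    simpl in HX.
  - destruct (i <? d); [inversion HX |].
    destruct (undis_rule_lift _ _ _ _ _ _ HX) as [[H _] | H]; lia.
  - apply undis_rule_Node in HX;
    destruct HX as [[Ht ->] | (E & HE & HX')].
    + exists (map concl ds); replace t with (Some j); [constructor | symmetry].
      destruct t as [i |]; simpl in Ht; [| discriminate].
      destruct (i <? d); [assumption |].
      destruct (r (i - d)); simpl in Ht; [injection Ht as Ht; lia | discriminate].
    + apply in_map_iff in HE; destruct HE as (F & <- & HF).
      destruct (IH F HF (S d) (S j) X Xs) as [Bs HB]; [lia | assumption |].
      exists Bs; econstructor; eauto.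
Qed.

Lemma argstr_subst s r D : good_subst s ->
  forall d, argstr D -> argstr (subst s r d D).
Proof.
  intros Hs; induction D as [A i | A t ds IH] using astr_nested_ind;
    intros d HD; simpl.
  - destruct (i <? d); [constructor |]; apply argstr_lift, Hs.
  - inversion HD as [| ? ? ? Hall _ _]; subst.
    eapply argstr_map_node; [| | | | | exact HD].
    + auto.
    + intros; now apply concl_subst.
    + intros E X _; apply undis_subst; lia.
    + intros E X Xs _; apply undis_rule_subst; lia.
    + now destruct t.
Qed.

Lemma subst_nameless s r D : forall d,
  (forall i A, undis D i A -> i < d) ->
  (forall i A As, undis_rule D i A As -> i < d) ->
  subst s r d D = D.
Proof.
  induction D as [A i | A t ds IH] using astr_nested_ind; intros d Hu Hr; simpl.
  - assert (H : i < d) by (apply (Hu i A); constructor).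
    now apply Nat.ltb_lt in H; rewrite H.
  - f_equal.
    + destruct t as [i |]; simpl; [| reflexivity].
      assert (H : i < d) by (eapply Hr; constructor).
      now apply Nat.ltb_lt in H; rewrite H.
    + rewrite <- (map_id ds) at 2; apply map_ext_in; intros E HE.
      apply IH; [assumption | |].
      * intros [| i] X HX; [lia |]; apply -> Nat.succ_lt_mono.
        apply (Hu i X); econstructor; eauto.
      * intros [| i] X Xs HX; [lia |]; apply -> Nat.succ_lt_mono.
        apply (Hr i X Xs); econstructor; eauto.
Qed.

Lemma instance_exists (V : form -> astr -> Prop) D : forall d,
  (forall i A, undis D i A -> d <= i ->
     exists E, argstr E /\ closed E /\ concl E = A /\ V A E) ->
  exists D', instance V d D D'.
Proof.
  induction D as [A i | A t ds IH] using astr_nested_ind; intros d HV.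
  - destruct (Nat.lt_ge_cases i d) as [Hlt | Hle].
    + exists (Hyp A i); now constructor.
    + destruct (HV i A) as (E & ? & ? & ? & ?); [constructor | assumption |].
      exists (lift d 0 E); now constructor.
  - assert (H : exists ds', Forall2 (instance V (S d)) ds ds').
    { assert (HE : forall E, In E ds -> exists E', instance V (S d) E E').
      { intros E HE; apply IH; [assumption |]; intros [| i] X HX Hle; [lia |].
        apply (HV i); [econstructor; eauto | lia]. }
      clear IH HV; induction ds as [| E ds IHds]; [now exists [] |].
      destruct (HE E) as [E' ?]; [now left |].
      destruct IHds as [ds' ?]; [intros; apply HE; now right |].
      exists (E' :: ds'); now constructor. }
    destruct H as [ds' H]; exists (Node A t ds'); now constructor.
Qed.

(** * Constant reductions *)

(** No inference of [E] is left to be discharged further below, so that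
    renamings do not affect [E]. *)
Definition nameless (E : astr) : Prop :=
  forall i A As, ~ undis_rule E i A As.

(** The map that sends every inference whose conclusion is that of [E], open or
    closed, to [E]. *)
Definition constant_map (E : astr) : pmap := fun D =>
  if excluded_middle_informative
       (argstr D /\ exists t ds, D = Node (concl E) t ds)
  then Some E else None.

Lemma constant_map_Some E D F :
  constant_map E D = Some F ->
  F = E /\ argstr D /\ exists t ds, D = Node (concl E) t ds.
Proof.
  unfold constant_map; destruct excluded_middle_informative as [H |];
    [intros [= <-]; auto | discriminate].
Qed.

Lemma constant_map_Node E t ds :
  argstr (Node (concl E) t ds) -> constant_map E (Node (concl E) t ds) = Some E.
Proof.
  intros H; unfold constant_map; destruct excluded_middle_informative as [| Hn];
    [reflexivity |].
  destruct Hn; eauto.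
Qed.

Lemma constant_reduction E :
  argstr E -> closed E -> nameless E -> reduction (constant_map E).
Proof.
  intros Ha Hc Hn; exists (fun _ => True).
  assert (HE : forall s r, subst s r 0 E = E).
  { intros s r; apply subst_nameless.
    - intros i A H; destruct (Hc i A H).
    - intros i A As H; destruct (Hn i A As H). }
  split; [| split; [| split; [| split]]].
  - intros D F H; apply constant_map_Some in H.
    destruct H as (-> & HD & t & ds & ->); split; [assumption |].
    split; [assumption |]; exists (ds, concl E); split; [exact I | now exists t].
  - intros D F H; apply constant_map_Some in H.
    destruct H as (-> & HD & t & ds & ->); split; [reflexivity |].
    intros i A H; destruct (Hc i A H).
  - intros D F H; apply constant_map_Some in H; destruct H as (-> & _).
    intros i A As H; destruct (Hn i A As H).
  - intros D F H s r Hs; apply constant_map_Some in H.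
    destruct H as (-> & HD & t & ds & ->); rewrite HE.
    exact (constant_map_Node E _ _ (argstr_subst s r _ Hs 0 HD)).
  - intros D F HD H; apply constant_map_Some in H; destruct H as (_ & _ & t & ds & H).
    exists E; destruct D as [A i | A t' ds'];
      unfold forget in H; simpl in H; [discriminate |].
    injection H as -> _ _; now apply constant_map_Node.
Qed.

Definition has_all_reductions (J : pmap -> Prop) : Prop :=
  forall phi, reduction phi -> J phi.

Lemma reduces_constant J A t ds E :
  has_all_reductions J -> argstr (Node A t ds) ->
  argstr E -> closed E -> nameless E -> concl E = A ->
  reduces J (Node A t ds) E.
Proof.
  intros HJ HD Ha Hc Hn <-; apply rt_step, step_root with (constant_map E).
  - now apply HJ, constant_reduction.
  - now apply constant_map_Node.
Qed.

Lemma argstr_Node_None A ds :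
  (forall E, In E ds -> argstr E) -> ~ gh_value ds -> argstr (Node A None ds).
Proof. intros Hds Hgh; constructor; [assumption | contradiction |]; now intros []. Qed.

(** The lift keeps everything in [E] from being discharged by the new node. *)
Lemma argstr_Node_lift A E : argstr E -> argstr (Node A None [lift 1 0 E]).
Proof.
  intros HE; apply argstr_Node_None.
  - intros F [<- | []]; now apply argstr_lift.
  - intros (F & X & Xs & [<- | []] & HX).
    destruct (undis_rule_lift _ _ _ _ _ _ HX) as [[H _] | H]; lia.
Qed.

(** * Derivability in atomic bases *)

(** [derivable S a]: the atom [a] is derivable by the rules in [S]; rules
    discharged by an inference are simply added to [S] above it. *)
Inductive derivable : ruleset -> atom -> Prop :=
| derivable_app (S : ruleset) ps a :
    S (ARule ps a) ->
    (forall p, In p ps -> derivable (fun R => S R \/ In R (fst p)) (snd p)) ->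
    derivable S a.

Lemma derivable_mono S T a :
  (forall R, S R -> T R) -> derivable S a -> derivable T a.
Proof.
  intros HST HS; revert T HST.
  induction HS as [S ps a Ha _ IH]; intros T HST.
  apply derivable_app with ps; [auto |].
  intros p Hp; apply (IH p Hp); intros R [H | H]; auto.
Qed.

(** [S] with the atom [p] as an axiom. *)
Definition add_axiom (p : atom) (S : ruleset) : ruleset :=
  fun R => S R \/ R = ARule [] p.

(** A derivation of [p] can be put in the place of the axiom [p], at every depth:
    the rules discharged below it only add to those it may use. *)
Lemma derivable_cut S T p a :
  (forall R, S R -> add_axiom p T R) ->
  derivable T p -> derivable S a -> derivable T a.
Proof.
  intros HST HT HS; revert T HST HT.
  induction HS as [S ps a Ha _ IH]; intros T HST HT.
  destruct (HST _ Ha) as [H | [= -> ->]]; [| assumption].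
  apply derivable_app with ps; [assumption |].
  intros p' Hp'; apply (IH p' Hp').
  - intros R [HR | HR]; [destruct (HST _ HR) as [|] |]; unfold add_axiom; auto.
  - eapply derivable_mono; [| exact HT]; auto.
Qed.

Lemma derivation_derivable B D : forall ctx a S,
  derivation B ctx D a ->
  (forall R, B R -> S R) ->
  (forall Rs R, In Rs ctx -> In R Rs -> S R) ->
  derivable S a.
Proof.
  induction D as [A i | A t ds IH] using astr_nested_ind;
    intros ctx a S HD HB Hctx; inversion HD as [? ? ps ? ? Ht Hds]; subst.
  apply derivable_app with ps.
  - destruct t as [i |]; [| auto].
    destruct (nth_error ctx i) as [Rs |] eqn:Hi; [| auto].
    destruct Ht as [HR _]; eauto using nth_error_In.
  - intros p Hp.
    assert (H : exists D, In D ds /\ derivation B (fst p :: ctx) D (snd p)).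
    { clear HD IH Ht; induction Hds as [| p' D ps ds HpD Hds IHds]; [destruct Hp |].
      destruct Hp as [-> | Hp]; [exists D; split; [now left | assumption] |].
      destruct (IHds Hp) as (E & ? & ?); exists E; split; [now right | assumption]. }
    destruct H as (D & HDin & HpD).
    apply (IH D HDin _ _ _ HpD); [auto |].
    intros Rs R [<- | HRs] HR; eauto.
Qed.

Lemma derivable_derivation B S a ctx :
  derivable S a ->
  (forall R, S R -> B R \/ exists Rs, In Rs ctx /\ In R Rs) ->
  exists D, derivation B ctx D a /\
            forall i A As, undis_rule D i A As -> i < length ctx.
Proof.
  intros HS; revert ctx; induction HS as [S ps a Ha _ IH]; intros ctx Hctx.
  assert (Hds : exists ds,
      Forall2 (fun p D => derivation B (fst p :: ctx) D (snd p)) ps ds /\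
      forall D, In D ds -> forall i A As, undis_rule D i A As -> i < 1 + length ctx).
  { assert (H : forall p, In p ps -> exists D,
        derivation B (fst p :: ctx) D (snd p) /\
        forall i A As, undis_rule D i A As -> i < 1 + length ctx).
    { intros p Hp; apply (IH p Hp (fst p :: ctx)).
      intros R [HR | HR]; [| right; exists (fst p); split; [now left | assumption]].
      destruct (Hctx R HR) as [| (Rs & ? & ?)]; [now left |].
      right; exists Rs; split; [now right | assumption]. }
    clear Ha IH; induction ps as [| p ps IHps]; [exists []; split; [constructor | easy] |].
    destruct (H p) as (D & HD & HDn); [now left |].
    destruct IHps as (ds & Hds & Hdsn); [intros; apply H; now right |].
    exists (D :: ds); split; [now constructor |].
    intros E [<- | HE]; [exact HDn | exact (Hdsn E HE)]. }
  destruct Hds as (ds & Hds & Hn).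
  (* A rule with premises may be discharged only if it is not in [B]. *)
  destruct (classic (B (ARule ps a))) as [HB | HB].
  - exists (Node (Atom a) None ds); split; [now apply derivation_app with ps |].
    intros i A As HA; inversion HA; subst.
    apply Nat.succ_lt_mono; eapply Hn; eassumption.
  - destruct (Hctx _ Ha) as [| (Rs & HRs & HR)]; [contradiction |].
    apply In_nth_error in HRs; destruct HRs as [i Hi].
    exists (Node (Atom a) (Some i) ds); split.
    + apply derivation_app with ps; [| assumption]; rewrite Hi; auto.
    + intros j A As HA; inversion HA; subst.
      * apply nth_error_Some; now rewrite Hi.
      * apply Nat.succ_lt_mono; eapply Hn; eassumption.
Qed.

Lemma derivation_argstr B D : forall ctx a,
  derivation B ctx D a -> argstr D /\ closed D /\ concl D = Atom a.
Proof.
  induction D as [A i | A t ds IH] using astr_nested_ind;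
    intros ctx a HD; inversion HD as [? ? ps ? ? _ Hds]; subst.
  assert (H : forall E, In E ds -> argstr E /\ closed E /\ atomic (concl E)).
  { intros E HE.
    assert (HE' : exists ctx b, derivation B ctx E b).
    { clear HD IH; induction Hds as [| p D ps ds HpD _ IHds]; [destruct HE |].
      destruct HE as [-> | HE]; eauto. }
    destruct HE' as (ctx' & b & HE').
    destruct (IH E HE _ _ HE') as (? & ? & ?); unfold atomic; eauto. }
  assert (Hs : atomic_step (Atom a) ds /\ ~ f_value ds).
  { split; [split; [now exists a | apply H] |].
    intros (E & X & HE & HX); destruct (H E HE) as (_ & Hc & _); exact (Hc _ _ HX). }
  split; [| split; [| reflexivity]].
  - constructor; [apply H | auto | auto].
  - intros i A HA; inversion HA as [| ? ? ? E ? ? HE HX]; subst.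
    destruct (H E HE) as (_ & Hc & _); exact (Hc _ _ HX).
Qed.

Lemma closed_valid_derivable n B J a D :
  reductions J -> concl D = Atom a -> closed_valid n (Atom a) B J D -> derivable B a.
Proof.
  intros HJ HD (E & HE & b & Hb).
  destruct (reduces_sound _ _ _ HJ HE) as [Hc _].
  destruct (derivation_argstr _ _ _ _ Hb) as (_ & _ & Hb').
  replace a with b by congruence.
  eapply derivation_derivable; [exact Hb | auto | easy].
Qed.

Lemma derivable_closed_valid n B J a t ds :
  has_all_reductions J -> argstr (Node (Atom a) t ds) ->
  derivable B a -> closed_valid n (Atom a) B J (Node (Atom a) t ds).
Proof.
  intros HJ HD Ha.
  destruct (derivable_derivation B B a [] Ha) as (E & HE & Hn); [auto |].
  destruct (derivation_argstr _ _ _ _ HE) as (H1 & H2 & H3).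
  exists E; split; [| now exists a].
  apply reduces_constant; auto.
  intros i A As HA; exact (Nat.nlt_0_r _ (Hn i A As HA)).
Qed.

Lemma extends_add_axiom n p B C :
  extends n B C -> extends n C (add_axiom p C).
Proof.
  intros (_ & [Hexp Hsame] & Hlev); split; [now left |]; split; [split |].
  - intros a; left; apply Hexp.
  - intros R R' HR [H | ->]; [left; eauto |].
    inversion HR as [ps qs a HF]; subst; inversion HF; subst; now right.
  - intros R [H | ->]; [now apply Hlev |]; right; simpl; lia.
Qed.

(** * Splitting a disjunction under an atomic premise *)

Lemma closed_valid_or_derivable n B J q r D :
  reductions J -> closed_valid n (Or (Atom q) (Atom r)) B J D ->
  derivable B q \/ derivable B r.
Proof.
  intros HJ (D1 & _ & _ & [[Hc H] | [Hc H]]); [left | right];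
    eapply closed_valid_derivable; eauto.
Qed.

Lemma split_derivable n B C J p q r D :
  reductions J -> extends n B C -> closed D ->
  closed_valid n (Imp (Atom p) (Or (Atom q) (Atom r))) C J D ->
  derivable (add_axiom p C) q \/ derivable (add_axiom p C) r.
Proof.
  intros HJ HC HD (D1 & Hr & Hcan & Hcl & Hop).
  destruct (classic (closed D1)) as [H1 | H1].
  - assert (Hmono : forall a, derivable C a -> derivable (add_axiom p C) a)
      by (intros a; apply derivable_mono; now left).
    destruct (closed_valid_or_derivable _ _ _ _ _ _ HJ (Hcl H1)); auto.
  - pose proof (extends_add_axiom n p B C HC) as Hext.
    destruct (instance_exists
      (fun _ E => closed_valid n (Atom p) (add_axiom p C) J E) D1 0) as [D' HD'].
    + intros i A HA _.
      (* All the undischarged assumptions of [D1] are [p], since [D] is closed. *)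
      assert (A = Atom p) as ->.
      { destruct i as [| i]; [inversion Hcan; auto |].
        destruct (reduces_sound _ _ _ HJ Hr) as (_ & Hu & _).
        destruct (HD i A); apply Hu; econstructor; [now left | exact HA]. }
      assert (Hp : derivation (add_axiom p C) [] (Node (Atom p) None []) p)
        by (apply derivation_app with []; [now right | constructor]).
      exists (Node (Atom p) None []).
      destruct (derivation_argstr _ _ _ _ Hp) as (? & ? & ?).
      repeat (split; [assumption |]).
      exists (Node (Atom p) None []); split; [apply rt_refl | now exists p].
    + eapply closed_valid_or_derivable; [exact HJ |].
      apply (Hop H1 J (add_axiom p C) D'); auto.
Qed.

(** The proof of [p -> q] by an arbitrary inference of [q] from [p], whose
    meaning is left to the reductions. *)
Definition imp_structure (p q : atom) : astr :=
  Node (Imp (Atom p) (Atom q)) None [Node (Atom q) None [Hyp (Atom p) 1]].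

Lemma undis_imp_premise p q i A :
  undis (Node (Atom q) None [Hyp (Atom p) 1]) i A -> i = 0 /\ A = Atom p.
Proof.
  intros HA; inversion HA as [| ? ? ? E ? ? HE HX]; subst;
    destruct HE as [<- | []].
  inversion HX; auto.
Qed.

Lemma nameless_imp_premise p q :
  nameless (Node (Atom q) None [Hyp (Atom p) 1]).
Proof.
  intros i A As HA; inversion HA as [| ? ? ? E ? ? ? HE HX]; subst;
    destruct HE as [<- | []].
  inversion HX.
Qed.

Lemma closed_imp_structure p q : closed (imp_structure p q).
Proof.
  intros i A HA; inversion HA as [| ? ? ? E ? ? HE HX]; subst;
    destruct HE as [<- | []].
  apply undis_imp_premise in HX; now destruct HX.
Qed.

Lemma nameless_imp_structure p q : nameless (imp_structure p q).
Proof.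
  intros i A As HA; inversion HA as [| ? ? ? E ? ? ? HE HX]; subst;
    destruct HE as [<- | []].
  exact (nameless_imp_premise _ _ _ _ _ HX).
Qed.

Lemma argstr_imp_structure p q : argstr (imp_structure p q).
Proof.
  apply argstr_Node_None.
  - intros E [<- | []].
    exact (argstr_Node_lift (Atom q) (Hyp (Atom p) 0) (argstr_hyp _ _)).
  - intros (E & X & Xs & [<- | []] & HX).
    exact (nameless_imp_premise _ _ _ _ _ HX).
Qed.

Lemma valid_imp_structure n C J p q :
  has_all_reductions J -> derivable (add_axiom p C) q ->
  closed_valid n (Imp (Atom p) (Atom q)) C J (imp_structure p q).
Proof.
  intros HJ Hq.
  exists (Node (Atom q) None [Hyp (Atom p) 1]).
  split; [apply rt_refl |]; split; [| split].
  - constructor; [reflexivity |]; intros Z HZ; now apply undis_imp_premise in HZ.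
  - intros Hc; destruct (Hc 0 (Atom p)); econstructor; [now left | constructor].
  - intros _ J' C' D' HJ' HJJ' HC' HD'.
    inversion HD' as [| | ? ? ? ? ds' Hds]; subst.
    inversion Hds as [| ? E' ? l HE' Hl]; subst; inversion Hl; subst.
    inversion HE' as [| ? ? ? E Hle HE Hc Hp HV |]; subst; [lia |].
    apply derivable_closed_valid; [intros phi Hphi; auto | |].
    + now apply argstr_Node_lift.
    + apply derivable_cut with (add_axiom p C) p; [| | assumption].
      * intros R [HR | ->]; [left; now apply HC' | now right].
      * eapply closed_valid_derivable; eauto.
Qed.

Lemma valid_split n C J p q r E :
  has_all_reductions J -> argstr E ->
  derivable (add_axiom p C) q \/ derivable (add_axiom p C) r ->
  closed_valid n (Or (Imp (Atom p) (Atom q)) (Imp (Atom p) (Atom r))) C J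
    (Node (Or (Imp (Atom p) (Atom q)) (Imp (Atom p) (Atom r))) None [lift 1 0 E]).
Proof.
  intros HJ HE Hqr.
  assert (HD : exists D,
      D = imp_structure p q /\ derivable (add_axiom p C) q \/
      D = imp_structure p r /\ derivable (add_axiom p C) r)
    by (destruct Hqr; eauto).
  destruct HD as [D HD].
  assert (H : argstr D /\ closed D /\ nameless D).
  { destruct HD as [[-> _] | [-> _]];
      auto using argstr_imp_structure, closed_imp_structure, nameless_imp_structure. }
  destruct H as (Ha & Hc & Hn).
  assert (Hf : ~ f_value [D]).
  { intros (F & X & [<- | []] & HX); exact (Hc _ _ HX). }
  exists D; split; [| split].
  - apply reduces_constant; [assumption | now apply argstr_Node_lift | | | |].
    + apply argstr_Node_None; [intros F [<- | []]; assumption |].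
      intros (F & X & Xs & [<- | []] & HX); exact (Hn _ _ _ HX).
    + intros i X HX; inversion HX as [| ? ? ? F ? ? HF HX']; subst;
        destruct HF as [<- | []].
      exact (Hc _ _ HX').
    + intros i X Xs HX; inversion HX as [| ? ? ? F ? ? ? HF HX']; subst;
        destruct HF as [<- | []].
      exact (Hn _ _ _ HX').
    + reflexivity.
  - destruct HD as [[-> _] | [-> _]];
      [now apply canonical_or1 | now apply canonical_or2].
  - destruct HD as [[-> H] | [-> H]]; [left | right];
      (split; [reflexivity | now apply valid_imp_structure]).
Qed.

Lemma consequence_split n p q r :
  consequence n [Imp (Atom p) (Or (Atom q) (Atom r))]
    (Or (Imp (Atom p) (Atom q)) (Imp (Atom p) (Atom r))).
Proof.
  set (X := Imp _ (Or _ _)); set (A := Or (Imp _ _) _).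
  (* With index 1 the assumption [X] is not discharged by the inference below. *)
  exists (Node A None [Hyp X 1]), reduction.
  assert (HX : undis (Node A None [Hyp X 1]) 0 X)
    by (econstructor; [now left | constructor]).
  split; [| split; [| split]].
  - exact (argstr_Node_lift A (Hyp X 0) (argstr_hyp _ _)).
  - easy.
  - split; [| reflexivity]; intros Y; split.
    + intros [<- | []]; eauto.
    + intros [i HY]; inversion HY as [| ? ? ? E ? ? HE HY']; subst;
        destruct HE as [<- | []].
      inversion HY'; now left.
  - intros B HB; split; [intros Hc; destruct (Hc _ _ HX) |].
    intros _ J C D' HJ HJall HC HD'.
    inversion HD' as [| | ? ? ? ? ds' Hds]; subst.
    inversion Hds as [| ? E' ? l HE' Hl]; subst; inversion Hl; subst.
    inversion HE' as [| ? ? ? E Hle HE Hc Hp HV |]; subst; [lia |].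
    apply valid_split; [assumption | assumption |].
    now apply (split_derivable n B C J p q r E).
Qed.

(** * A Kripke countermodel *)

(** The worlds are the root [None] and its two successors [Some true] and
    [Some false]. *)
Definition world : Type := option bool.

Definition above (w v : world) : Prop := w = None \/ w = v.

Fixpoint forces (val : world -> nat -> Prop) (w : world) (X : form) : Prop :=
  match X with
  | Atom (Letter k) => val w k
  | Atom Falsum => False
  | And Y Z => forces val w Y /\ forces val w Z
  | Or Y Z => forces val w Y \/ forces val w Z
  | Imp Y Z => forall v, above w v -> forces val v Y -> forces val v Z
  end.

Definition persistent (val : world -> nat -> Prop) : Prop :=
  forall w v k, above w v -> val w k -> val v k.

Lemma above_trans u v w : above u v -> above v w -> above u w.
Proof. unfold above; intros [-> | ->] [-> | ->]; auto. Qed.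

Lemma forces_mono val w v X :
  persistent val -> above w v -> forces val w X -> forces val v X.
Proof.
  intros Hval; revert w v; induction X as [[k |] | Y IHY Z IHZ | Y IHY Z IHZ | Y _ Z _];
    simpl; intros w v Hwv H.
  - eapply Hval; eauto.
  - assumption.
  - destruct H; split; eauto.
  - destruct H; [left | right]; eauto.
  - eauto using above_trans.
Qed.

Lemma IL_sound val G X :
  persistent val -> IL G X ->
  forall w, (forall Y, In Y G -> forces val w Y) -> forces val w X.
Proof.
  intros Hval HX; induction HX; intros w HG; simpl in *.
  - auto.
  - auto.
  - now apply IHHX.
  - now apply IHHX.
  - auto.
  - auto.
  - destruct (IHHX1 w HG) as [H | H]; [apply IHHX2 | apply IHHX3];
      intros U [<- | HU]; auto.
  - intros v Hwv HvX; apply IHHX; intros U [<- | HU]; [assumption |].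
    eapply forces_mono; eauto.
  - apply (IHHX1 w HG w); [now right | auto].
  - destruct (IHHX w HG).
Qed.

Lemma not_IL_split p q r : p <> q -> p <> r -> q <> r ->
  ~ IL [Imp (Atom (Letter p)) (Or (Atom (Letter q)) (Atom (Letter r)))]
       (Or (Imp (Atom (Letter p)) (Atom (Letter q)))
           (Imp (Atom (Letter p)) (Atom (Letter r)))).
Proof.
  intros Hpq Hpr Hqr H.
  set (val := fun (w : world) (k : nat) =>
    match w with
    | None => False
    | Some b => k = p \/ k = if b then q else r
    end).
  assert (Hval : persistent val)
    by (intros w v k [-> | <-] Hk; [destruct Hk | assumption]).
  assert (H0 := IL_sound val _ _ Hval H None); simpl in H0.
  destruct H0 as [H0 | H0].
  - intros Y [<- | []] [[|] |] _; simpl; [tauto | tauto | intros []].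
  - destruct (H0 (Some false)); [now left | now left | |]; congruence.
  - destruct (H0 (Some true)); [now left | now left | |]; congruence.
Qed.

Theorem theorem3 : forall n : nat,
  exists (Gamma : list form) (A : form),
    consequence n Gamma A /\ ~ IL Gamma A.
Proof.
  intros n; do 2 eexists; split.
  - apply (consequence_split n (Letter 0) (Letter 1) (Letter 2)).
  - now apply not_IL_split.
Qed.
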